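(* Let $\mu$ be an irreducible, symmetric probability measure on $\mathrm{Homeo}^+(\mathbf{R})$. Then for every $x\in\mathbf{R}$, almost surely $$\limsup_{n\to\infty} X_n^x=+\infty\quad\text{and}\quad \liminf_{n\to\infty}X_n^x=-\infty .$$
   Context: $\mathrm{Homeo}^+(\mathbf{R})$ is the group of orientation-preserving (increasing) homeomorphisms of the real line. All probability measures $\mu$ on it are supported on countable sets, viewed as discrete measures; $G$ denotes the (countable) group generated by the support of $\mu$. The measure $\mu$ is symmetric if $\mu(g)=\mu(g^{-1})$ for all $g$, and irreducible if $G$ has no global fixed point, i.e. for every $x\in\mathbf{R}$ there is $g\in G$ with $g(x)\neq x$. Let $g_1,g_2,\dots$ be i.i.d. random homeomorphisms with distribution $\mu$, and set $f_n=g_n\circ\cdots\circ g_1$ and $X_n^x=f_n(x)$ (with $X_0^x=x$). *)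

(* Defs.v *)
From HB Require Import structures.
From mathcomp Require Import all_boot all_order all_algebra finmap.
From mathcomp Require Import all_classical all_reals all_analysis.

Set Implicit Arguments.
Unset Strict Implicit.
Unset Printing Implicit Defensive.

Import Order.TTheory GRing.Theory Num.Theory.
Import numFieldNormedType.Exports.

Local Open Scope classical_set_scope.
Local Open Scope ring_scope.

(* Homeo^+(R): the inverse is kept as data, but it is determined by the
   function, so that equality in [homeo R] is equality of functions (see
   [homeo_eqP]). *)
Record homeo (R : realType) := Homeo {
  homeo_fun :> R -> R ;
  homeo_inv : R -> R ;
  homeo_funK : cancel homeo_fun homeo_inv ;
  homeo_invK : cancel homeo_inv homeo_fun ;
  homeo_continuous : continuous homeo_fun ;
  homeo_inv_continuous : continuous homeo_inv ;
  homeo_increasing : {homo homeo_fun : x y / x < y} }.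

Lemma homeo_eqP (R : realType) (f g : homeo R) : f =1 g -> f = g.
Proof.
case: f g => f f' fK f'K cf cf' incf [g g' gK g'K cg cg' incg] /= fg.
have Efg : f = g by apply/funext.
subst g.
have Efg' : f' = g' by apply/funext => y; rewrite -{1}(g'K y) fK.
subst g'.
by congr Homeo; exact: Prop_irrelevance.
Qed.

Section homeo_group.
Variable R : realType.
Implicit Types f g h : homeo R.

Definition homeo_one : homeo R :=
  @Homeo R id id (fun=> erefl) (fun=> erefl) (fun _ => cvg_id)
    (fun _ => cvg_id) (fun _ _ => id).

Lemma homeo_inv_increasing f : {homo homeo_inv f : x y / x < y}.
Proof.
move=> x y xy; rewrite ltNge; apply/negP; rewrite le_eqVlt => /orP[/eqP e|].
  by move: xy; rewrite -(homeo_invK f x) -(homeo_invK f y) e ltxx.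
by move=> /(@homeo_increasing R f); rewrite !homeo_invK ltNge (ltW xy).
Qed.

Definition homeo_inverse f : homeo R :=
  @Homeo R (homeo_inv f) f (@homeo_invK R f) (@homeo_funK R f)
    (@homeo_inv_continuous R f) (@homeo_continuous R f)
    (@homeo_inv_increasing f).

Definition homeo_comp f g : homeo R :=
  @Homeo R (f \o g) (homeo_inv g \o homeo_inv f)
    (can_comp (@homeo_funK R f) (@homeo_funK R g))
    (can_comp (@homeo_invK R g) (@homeo_invK R f))
    (fun x => continuous_comp (@homeo_continuous R g x)
                              (@homeo_continuous R f (g x)))
    (fun x => continuous_comp (@homeo_inv_continuous R f x)
                              (@homeo_inv_continuous R g (homeo_inv f x)))
    (fun x y xy => homeo_increasing f (homeo_increasing g xy)).

Lemma homeo_compA : associative homeo_comp.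
Proof. by move=> f g h; exact: homeo_eqP. Qed.

Lemma homeo_comp1f : left_id homeo_one homeo_comp.
Proof. by move=> f; exact: homeo_eqP. Qed.

Lemma homeo_compf1 : right_id homeo_one homeo_comp.
Proof. by move=> f; exact: homeo_eqP. Qed.

Lemma homeo_compVf : left_inverse homeo_one homeo_inverse homeo_comp.
Proof. by move=> f; apply: homeo_eqP => x /=; rewrite homeo_funK. Qed.

Lemma homeo_compfV : right_inverse homeo_one homeo_inverse homeo_comp.
Proof. by move=> f; apply: homeo_eqP => x /=; rewrite homeo_invK. Qed.

HB.instance Definition _ := gen_eqMixin (homeo R).
HB.instance Definition _ := gen_choiceMixin (homeo R).
HB.instance Definition _ := isPointed.Build (homeo R) homeo_one.
HB.instance Definition _ := isGroup.Build (homeo R)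
  homeo_compA homeo_comp1f homeo_compf1 homeo_compVf homeo_compfV.

(* Measures on Homeo^+(R) are discrete, so every subset is measurable. *)
HB.instance Definition _ := @isMeasurable.Build default_measure_display
  (homeo R) discrete_measurable discrete_measurable0
  discrete_measurableC discrete_measurableU.

End homeo_group.

Lemma homeo_mulE (R : realType) (f g : homeo R) (x : R) :
  (f * g)%g x = f (g x).
Proof. by []. Qed.

Section discrete_measures.
Variable R : realType.
Implicit Type mu : probability (homeo R) R.

Definition countably_supported mu :=
  exists C : set (homeo R), countable C /\ mu C = 1%E.

Definition msupport mu : set (homeo R) := [set g | mu [set g] != 0%E].

Definition generated_group (S : set (homeo R)) : set (homeo R) :=
  smallest [set H : set (homeo R) | group_closed (mem H)] S.

Definition symmetric_measure mu :=
  forall g : homeo R, mu [set g] = mu [set (g^-1)%g].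

Definition irreducible_measure mu :=
  forall x : R, exists2 g : homeo R,
    generated_group (msupport mu) g & g x != x.

End discrete_measures.

Section random_walk.
Context {d} {Omega : measurableType d} {R : realType}.
Variable P : probability Omega R.

Definition mutually_independent {d'} {T : measurableType d'}
    (X : nat -> {RV P >-> T}) :=
  forall (J : {fset nat}) (A : nat -> set T),
    (forall j, measurable (A j)) ->
    P (\bigcap_(j in [set` J]) (X j @^-1` A j)) =
    (\prod_(j <- J) P (X j @^-1` A j))%E.

Definition iid {d'} {T : measurableType d'} (mu : probability T R)
    (X : nat -> {RV P >-> T}) :=
  mutually_independent X /\
  forall n (A : set T), measurable A -> distribution P (X n) A = mu A.

(* [g n] stands for $g_{n+1}$: the increments are indexed from 0. *)
Fixpoint walk (g : nat -> {RV P >-> homeo R}) (n : nat) (w : Omega) :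
    homeo R :=
  if n is m.+1 then (g m w * walk g m w)%g else 1%g.

End random_walk.

(* Main.v *)
(* Fix M and let u(x) be the probability that the walk started at x stays
   forever in (-oo, M]; it suffices that u = 0 for all M and, by reflection,
   the same for the liminf. Let T be the Markov operator. Then u is
   nonincreasing, u = 1_{<= M} Tu, and u <= c P(stay up to time n) with
   c = sup u gives u <= c u, so that u > 1/2 somewhere, say at z, unless u = 0.
   - Since u is bounded and subharmonic, so is u^2, and T^n (u^2)(y) converges;
     hence T^n ((u o h - u)^2)(y) -> 0 for every h in G. By irreducibility some
     h in G pushes [z, M] to the right of M, where u = 0, and another pushes it
     to where u is bounded below, so that P(X_n^y in [z, M]) -> 0.
   - By symmetry, P(X_n^x <= y) = P(X_n^y >= x). Thus P(X_n^M >= z) =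
     P(X_n^z <= M) >= u(z) > 1/2 and P(X_n^M <= M) = P(X_n^M >= M), which
     forces P(X_n^M in [z, M]) >= u(z) - 1/2 for all n, a contradiction. *)
Require Import Defs.
From HB Require Import structures.
From mathcomp Require Import all_boot all_order all_algebra finmap.
From mathcomp Require Import all_classical all_reals all_analysis.
From mathcomp Require Import ring lra.
Import Order.TTheory GRing.Theory Num.Theory.
Import numFieldNormedType.Exports.
Local Open Scope classical_set_scope.
Local Open Scope ring_scope.
Set Implicit Arguments.
Unset Strict Implicit.
Unset Printing Implicit Defensive.

(** * Averages of bounded nonnegative functions on Homeo^+(R) *)

Section average.
Context {R : realType} (mu : probability (homeo R) R).
Implicit Types (phi psi : homeo R -> R) (a K : R).

Lemma homeo_measurable (A : set (homeo R)) : measurable A.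
Proof. by []. Qed.

Lemma homeo_measurable_fun d (T : measurableType d) (D : set (homeo R))
  (f : homeo R -> T) : measurable_fun D f.
Proof. by move=> mD Y mY. Qed.

Hint Resolve homeo_measurable homeo_measurable_fun : core.

(** Real-valued, so that linear and nonlinear arithmetic applies to averages; on [nnbounded]
    functions [fine] loses nothing ([avgE]). *)
Definition avg phi : R := fine (\int[mu]_h (phi h)%:E).

Definition nnbounded (T : Type) (phi : T -> R) :=
  exists K, forall t, 0 <= phi t <= K.

Lemma nnbounded_ge0 (T : Type) (phi : T -> R) t : nnbounded phi -> 0 <= phi t.
Proof. by move=> [K /(_ t)/andP[]]. Qed.

Lemma nnbounded_comp (S T : Type) (f : S -> T) (phi : T -> R) :
  nnbounded phi -> nnbounded (phi \o f).
Proof. by move=> [K phiK]; exists K => s; exact: phiK. Qed.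

Lemma nnboundedD (T : Type) (phi psi : T -> R) :
  nnbounded phi -> nnbounded psi -> nnbounded (fun t => phi t + psi t).
Proof.
move=> [K phiK] [L psiL]; exists (K + L) => t.
by have := phiK t; have := psiL t; lra.
Qed.

Lemma nnboundedM (T : Type) (phi psi : T -> R) :
  nnbounded phi -> nnbounded psi -> nnbounded (fun t => phi t * psi t).
Proof.
move=> [K phiK] [L psiL]; exists (K * L) => t.
have /andP[? ?] := phiK t; have /andP[? ?] := psiL t.
by rewrite mulr_ge0//= ler_pM.
Qed.

Lemma nnbounded_cst (T : Type) a : 0 <= a -> nnbounded (fun _ : T => a).
Proof. by move=> a0; exists a => _; rewrite a0 lexx. Qed.

Lemma integral_itv phi K : (forall h, 0 <= phi h <= K) ->
  (0 <= \int[mu]_h (phi h)%:E <= K%:E)%E.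
Proof.
move=> phiK; apply/andP; split.
  by apply: integral_ge0 => h _; rewrite lee_fin; have /andP[] := phiK h.
have -> : K%:E = (\int[mu]_(h in [set: homeo R]) (cst K%:E h))%E.
  by rewrite integral_cst// [X in (_ * X)%E]probability_setT mule1.
by apply: ge0_le_integral => // h _; rewrite lee_fin; have /andP[] := phiK h.
Qed.

Lemma avgE phi : nnbounded phi -> (avg phi)%:E = (\int[mu]_h (phi h)%:E)%E.
Proof.
move=> [K /integral_itv/andP[I0 IK]]; rewrite /avg fineK//.
by rewrite ge0_fin_numE// (le_lt_trans IK)// ltry.
Qed.

Lemma avg_itv phi K : (forall h, 0 <= phi h <= K) -> 0 <= avg phi <= K.
Proof.
move=> phiK; rewrite -!lee_fin avgE; first exact: integral_itv.
by exists K.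
Qed.

Lemma avg_cst a : 0 <= a -> avg (fun=> a) = a.
Proof.
move=> a0; apply/eqP; rewrite -eqe avgE; last exact: nnbounded_cst.
by rewrite integral_cst// [X in (_ * X)%E]probability_setT mule1.
Qed.

Lemma le_avg phi psi : nnbounded psi -> (forall h, 0 <= phi h <= psi h) ->
  avg phi <= avg psi.
Proof.
move=> [K psiK] phipsi; rewrite -lee_fin !avgE; last 2 first.
- by exists K.
- by exists K => h; have := psiK h; have := phipsi h; lra.
by apply: ge0_le_integral => // h _; rewrite lee_fin;
  have /andP[]// := phipsi h.
Qed.

Lemma avgD phi psi : nnbounded phi -> nnbounded psi ->
  avg (fun h => phi h + psi h) = avg phi + avg psi.
Proof.
move=> phib psib; apply/eqP; rewrite -eqe EFinD !avgE//; last exact: nnboundedD.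
apply/eqP; rewrite -ge0_integralD//.
- by move=> h _; rewrite lee_fin nnbounded_ge0.
- by move=> h _; rewrite lee_fin nnbounded_ge0.
Qed.

Lemma avgZ a phi : 0 <= a -> nnbounded phi ->
  avg (fun h => a * phi h) = a * avg phi.
Proof.
move=> a0 phib; apply/eqP; rewrite -eqe EFinM !avgE//; last first.
  exact/nnboundedM/phib/nnbounded_cst.
apply/eqP; under eq_integral do rewrite EFinM.
by rewrite ge0_integralZl// => h _; rewrite lee_fin nnbounded_ge0.
Qed.

Lemma avg_cvg (phi_ : nat -> homeo R -> R) phi K :
  (forall n h, 0 <= phi_ n h <= K) ->
  (forall h, phi_ n h @[n --> \oo] --> phi h) ->
  avg (phi_ n) @[n --> \oo] --> avg phi.
Proof.
move=> phiK phic; apply: fine_cvg; rewrite avgE.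
  apply: (@dominated_cvg _ _ _ _ _ _ _ _ (cst K%:E)) => //.
  - by move=> h _; apply: cvg_EFin; [exact: nearW|exact: phic].
  - exact: finite_measure_integrable_cst.
  - move=> n h _; have /andP[p0 pK] := phiK n h.
    by rewrite /= lee_fin ger0_norm.
exists K => h; apply/andP; split.
- by apply: (cvgr_to_ge (phic h)); apply: nearW => n; have /andP[] := phiK n h.
- by apply: (cvgr_to_le (phic h)); apply: nearW => n; have /andP[] := phiK n h.
Qed.

End average.

(** * Averages over a countable support: exchange and inversion *)

(** The pieces are the fibres of an injection of C into nat. Allowing empty pieces treats finite and
    infinite C alike. *)
Lemma countable_atoms (T : pointedType) (C : set T) : countable C ->
  exists (c : nat -> T) (F : nat -> set T),
    [/\ forall i, F i `<=` [set c i], trivIset setT F & \bigcup_i F i = C].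
Proof.
move=> /countable_injP[e einj].
(* On an empty fibre [get] returns a default point, which is harmless: the inclusion of [F i] in the
   singleton is then vacuous. *)
pose F i := [set h | C h /\ e h = i]; exists (fun i => get (F i)), F; split.
- move=> i h [Ch eh]; have [Cg eg] : F i (get (F i)) by apply: getPex; exists h.
  by apply: einj; rewrite ?inE// eh eg.
- apply/trivIsetP => i j _ _ /eqP ij; rewrite -subset0 => h [[_ ei] [_ ej]].
  by apply: ij; rewrite -ei.
- apply/seteqP; split=> [h [i _ []]//|h Ch].
  by exists (e h).
Qed.

Section countable_average.
Context {R : realType} (mu : probability (homeo R) R).
Hypothesis mu_countable : countably_supported mu.
Implicit Types (phi : homeo R -> R).

Hint Resolve homeo_measurable homeo_measurable_fun : core.

Lemma probability_atoms :
  exists (c : nat -> homeo R) (F : nat -> set (homeo R)),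
  [/\ forall i, F i `<=` [set c i], trivIset setT F & mu (\bigcup_i F i) = 1%E].
Proof.
have [C [/countable_atoms[c [F [Fc tF FC]]] muC]] := mu_countable.
by exists c, F; rewrite FC.
Qed.

Section atoms.
Variables (c : nat -> homeo R) (F : nat -> set (homeo R)).
Hypotheses (Fc : forall i, F i `<=` [set c i]) (tF : trivIset setT F)
  (muF : mu (\bigcup_i F i) = 1%E).

Lemma avg_atoms phi : nnbounded phi ->
  ((avg mu phi)%:E = \sum_(0 <= i <oo) (phi (c i))%:E * mu (F i))%E.
Proof.
move=> phib; rewrite avgE//.
have phi0 h : (0 <= (phi h)%:E)%E by rewrite lee_fin nnbounded_ge0.
have mF0 : mu (~` \bigcup_i F i) = 0%E.
  by rewrite probability_setC// muF subee.
rewrite -(setUv (\bigcup_i F i)) ge0_integral_setU//; last first.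
  by rewrite disj_set2E setICr.
rewrite [X in (_ + X)%E]null_set_integral// adde0 ge0_integral_bigcup//.
apply: eq_eseriesr => i _.
transitivity (\int[mu]_(h in F i) (cst (phi (c i))%:E h))%E.
  by apply: eq_integral => h /set_mem/Fc ->.
by rewrite integral_cst.
Qed.

End atoms.

(** The average over h is a series over the atoms, and it can be integrated in g term by term, so
    only the sections of psi enter. *)
Lemma avg_exchange (psi : homeo R -> homeo R -> R) K :
  (forall g h, 0 <= psi g h <= K) ->
  avg mu (fun g => avg mu (fun h => psi g h)) =
  avg mu (fun h => avg mu (fun g => psi g h)).
Proof.
move=> psiK; apply/eqP; rewrite -eqe; apply/eqP.
have [c [F [Fc tF muF]]] := probability_atoms.
have psib g : nnbounded (psi g) by exists K => h.
have psib' h : nnbounded (psi ^~ h) by exists K => g.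
rewrite avgE; last by exists K => g; apply: avg_itv => h.
under eq_integral do rewrite (avg_atoms Fc tF muF)//.
rewrite integral_nneseries//; last first.
  by move=> i g _; rewrite mule_ge0// lee_fin nnbounded_ge0.
rewrite (avg_atoms Fc tF muF)/=; last by exists K => h; apply: avg_itv => g.
apply: eq_eseriesr => i _; rewrite avgE// [RHS]muleC -ge0_integralZl//.
- by apply: eq_integral => g _; rewrite muleC.
- by move=> g _; rewrite lee_fin nnbounded_ge0.
Qed.

Hypothesis mu_symmetric : symmetric_measure mu.

(** Symmetry is given on singletons. Countable additivity extends it to countable sets, and any A
    can be cut down to a countable set of full measure. *)
Lemma preimage_inverse (A : set (homeo R)) :
  mu ((fun h => (h^-1)%g) @^-1` A) = mu A.
Proof.
have cA (B : set (homeo R)) :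
    countable B -> mu ((fun h => (h^-1)%g) @^-1` B) = mu B.
  move=> /countable_atoms[c [F [Fc tF <-]]].
  rewrite preimage_bigcup !measure_semi_bigcup//; last first.
    apply/trivIsetP => i j _ _ ij; rewrite -preimage_setI.
    move/trivIsetP : tF => /(_ i j Logic.I Logic.I ij) ->.
    by rewrite preimage_set0.
  apply: eq_eseriesr => i _.
  have [->|->] : F i = set0 \/ F i = [set c i] by exact/subset_set1/Fc.
    by rewrite preimage_set0.
  rewrite [RHS]mu_symmetric; congr (mu _); apply/seteqP; split => h /=.
    by move=> <-; rewrite invgK.
  by move=> ->; rewrite invgK.
have [C [cC muC]] := mu_countable.
have [muC0 muVC0] :
    mu (~` C) = 0%E /\ mu ((fun h => (h^-1)%g) @^-1` (~` C)) = 0%E.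
  by rewrite preimage_setC !probability_setC// cA// muC subee.
have E (m : probability (homeo R) R) (B D : set (homeo R)) :
    m (~` D) = 0%E -> m B = m (B `&` D).
  move=> mD; rewrite (measureDI _ (homeo_measurable B) (homeo_measurable D)).
  rewrite [X in (X + _)%E](_ : _ = 0%E) ?add0e//.
  by apply/eqP; rewrite -measure_le0 -mD le_measure ?inE//; exact: subIsetr.
(* A is cut by C, its preimage by the preimage of C; both have null complement, and the second cut
   is the preimage of the first. *)
rewrite (E mu A C)// (E mu _ ((fun h => (h^-1)%g) @^-1` C))// -preimage_setI.
by apply: cA; apply: sub_countable cC; apply: subset_card_le => h [].
Qed.

Lemma avg_inverse phi : nnbounded phi ->
  avg mu (fun h => phi (h^-1)%g) = avg mu phi.
Proof.
move=> phib; have phi0 h : (0 <= (phi h)%:E)%E by rewrite lee_fin nnbounded_ge0.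
apply/eqP; rewrite -eqe !avgE//; last exact: nnbounded_comp.
have mV : measurable_fun [set: homeo R] (fun h : homeo R => (h^-1)%g) by [].
apply/eqP; transitivity
    (\int[pushforward mu (fun h : homeo R => (h^-1)%g)]_h (phi h)%:E)%E.
  by rewrite ge0_integral_pushforward.
by apply: eq_measure_integral => A _ _; exact: preimage_inverse.
Qed.

End countable_average.

Lemma indicator_itv (R : numDomainType) (b : bool) : 0 <= (b%:R : R) <= 1.
Proof. by rewrite ler0n lern1 leq_b1. Qed.

(** * The Markov operator of an increasing action and its duality *)

Section markov_operator.
Context {R : realType} (mu : probability (homeo R) R).
Hypotheses (mu_countable : countably_supported mu)
  (mu_symmetric : symmetric_measure mu).
(* The action is a parameter in order to treat x |-> h x and its conjugate
   x |-> - h (- x) at once. *)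
Variable act : homeo R -> R -> R.
Hypotheses (act1 : forall x, act 1%g x = x)
  (actM : forall g h x, act (g * h)%g x = act g (act h x))
  (act_lt : forall h, {homo act h : x y / x < y}).
Implicit Types (phi psi : R -> R) (x y : R) (n : nat).

Definition step phi x := avg mu (fun h => phi (act h x)).

Lemma iter_step_itv n phi K : (forall x, 0 <= phi x <= K) ->
  forall x, 0 <= iter n step phi x <= K.
Proof.
by move=> phiK; elim: n => [//|n IH] x /=; apply: avg_itv => h; exact: IH.
Qed.

Lemma nnbounded_iter_step n phi : nnbounded phi -> nnbounded (iter n step phi).
Proof. by move=> [K phiK]; exists K; exact: iter_step_itv. Qed.

Lemma le_iter_step n phi psi :
  nnbounded psi -> (forall x, 0 <= phi x <= psi x) ->
  forall x, iter n step phi x <= iter n step psi x.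
Proof.
move=> psib phipsi x; suff /(_ x)/andP[] : forall x,
  0 <= iter n step phi x <= iter n step psi x by [].
elim: n {x} => [//|n IH] x /=.
rewrite le_avg ?andbT//; last exact/nnbounded_comp/nnbounded_iter_step.
have [K phiK] : nnbounded (iter n step phi).
  by apply: nnbounded_iter_step; have [K psiK] := psib;
    exists K => z; have := phipsi z; have := psiK z; lra.
by have /andP[] := @avg_itv _ mu (fun h => iter n step phi (act h x)) K
  (fun h => phiK _).
Qed.

Lemma iter_stepD n phi psi x : nnbounded phi -> nnbounded psi ->
  iter n step (fun x => phi x + psi x) x =
  iter n step phi x + iter n step psi x.
Proof.
move=> phib psib; elim: n x => [//|n IH] x /=.
rewrite /step -avgD//; last 2 first.
- exact/nnbounded_comp/nnbounded_iter_step.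
- exact/nnbounded_comp/nnbounded_iter_step.
by congr avg; apply/funext => h; exact: IH.
Qed.

Lemma iter_stepZ n a phi x : 0 <= a -> nnbounded phi ->
  iter n step (fun x => a * phi x) x = a * iter n step phi x.
Proof.
move=> a0 phib; elim: n x => [//|n IH] x /=.
rewrite /step -avgZ//; last exact/nnbounded_comp/nnbounded_iter_step.
by congr avg; apply/funext => h; exact: IH.
Qed.

Lemma iter_step_cst n a x : 0 <= a -> iter n step (fun=> a) x = a.
Proof.
move=> a0; elim: n x => [//|n IH] x /=.
by rewrite /step; under eq_fun do rewrite IH; rewrite avg_cst.
Qed.

Lemma le_act h : {homo act h : x y / x <= y}.
Proof. by move=> x y; rewrite le_eqVlt => /orP[/eqP->//|/(act_lt h)/ltW]. Qed.

Lemma actV h x : act (h^-1)%g (act h x) = x.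
Proof. by rewrite -actM mulVg act1. Qed.

Lemma act_leV h x y : (act (h^-1)%g x <= y) = (x <= act h y).
Proof.
apply/idP/idP => [/(le_act h)|/(le_act (h^-1)%g)]; last by rewrite actV.
by rewrite -actM mulgV act1.
Qed.

(* Both sides, as functions of x and y, are obtained from the indicator of
   x <= y by n steps acting on one variable; steps acting on x commute with
   steps acting on y, and by symmetry the first step may act on either. *)
Lemma step_duality n x y :
  iter n step (fun z => (z <= y)%R%:R) x =
  iter n step (fun z => (x <= z)%R%:R) y.
Proof.
pose b n x y := iter n step (fun z => (x <= z)%R%:R) y.
have b01 m u v : 0 <= b m u v <= 1.
  by apply: iter_step_itv => z; exact: indicator_itv.
have bS m u v : b m.+1 u v = avg mu (fun g => b m (act g u) v).
  elim: m u v => [|m IH] u v.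
    rewrite /b/= /step -(avg_inverse mu_countable mu_symmetric); last first.
      by exists 1 => h; exact: indicator_itv.
    by congr avg; apply/funext => h; rewrite -act_leV invgK.
  transitivity (avg mu (fun k => avg mu (fun g => b m (act g u) (act k v)))).
    by congr avg; apply/funext => k; rewrite -IH.
  by rewrite (avg_exchange mu_countable (K := 1)).
elim: n x y => [//|n IH] x y; rewrite -/(b n.+1 x y) bS/= /step.
by congr avg; apply/funext => h; rewrite IH.
Qed.

(** * Reachable group elements and unboundedness of orbits *)

Lemma avg_ge_atom (phi : homeo R -> R) h : nnbounded phi ->
  fine (mu [set h]) * phi h <= avg mu phi.
Proof.
move=> phib; rewrite -lee_fin avgE// EFinM fineK ?fin_num_measure//.
rewrite muleC -(@integral_cst _ _ _ mu)//.
rewrite (@eq_integral _ _ _ mu [set h] (fun k => (phi k)%:E)); last first.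
  by move=> k /set_mem ->.
apply: ge0_subset_integral => // k _.
by rewrite lee_fin nnbounded_ge0.
Qed.

(** An operator form of the statement that a product of k independent increments equals h with
    probability at least w > 0. *)
Definition reachable h := exists k (w : R), 0 < w /\
  forall phi, nnbounded phi -> forall x, w * phi (act h x) <= iter k step phi x.

Lemma reachableM g h : reachable g -> reachable h -> reachable (g * h)%g.
Proof.
move=> [k [w [w0 gP]]] [l [v [v0 hP]]]; exists (l + k)%N, (w * v).
split; first exact: mulr_gt0.
move=> phi phib x; rewrite actM iterD mulrAC.
apply: le_trans (hP _ (nnbounded_iter_step k phib) x).
by rewrite mulrC ler_wpM2l ?gP// ltW.
Qed.

(** The elements that are reachable together with their inverse form a subgroup; by symmetry of mu
    it contains the support. *)
Lemma generated_reachable h : generated_group (msupport mu) h ->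
  reachable h /\ reachable (h^-1)%g.
Proof.
move=> /(_ [set h | reachable h /\ reachable (h^-1)%g]); apply; split.
  split.
    by rewrite inE /=; rewrite invg1; split; exists 0%N, 1; split => // phi _ x;
      rewrite mul1r act1.
  move=> u v /[!inE]/= -[u1 u2] [v1 v2]; rewrite invgM invgK.
  by split; exact: reachableM.
have supp g : msupport mu g -> reachable g.
  rewrite /msupport/= => mug; exists 1%N, (fine (mu [set g])); split.
    by rewrite fine_gt0// lt0e mug measure_ge0/= ltey_eq fin_num_measure.
  by move=> phi phib x; apply: (@avg_ge_atom (fun h => phi (act h x)));
    exact: nnbounded_comp.
by move=> g gs; split; apply: supp => //; rewrite /msupport/= -mu_symmetric.
Qed.

Hypothesis act_irreducible : forall x,
  exists2 h, generated_group (msupport mu) h & act h x != x.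

(* Otherwise the infimum of the orbit of x would be a global fixed point. *)
Lemma reachable_lt x y :
  exists h, [/\ reachable h, reachable (h^-1)%g & act h x < y].
Proof.
pose A := [set act h x | h in [set h | generated_group (msupport mu) h]].
apply: contrapT => noh.
have lbA : lbound A y.
  move=> _ [h hG <-]; rewrite leNgt; apply/negP => hx; apply: noh; exists h.
  by have [] := generated_reachable hG.
have G1 : generated_group (msupport mu) 1%g by move=> H [[]]; rewrite inE.
have GV h : generated_group (msupport mu) h ->
    generated_group (msupport mu) (h^-1)%g.
  move=> hG H HP; have [Hg _] := HP; have := group_closedV Hg.
  by move=> /(_ h); rewrite !inE; apply; exact: hG.
have GM g h :
    generated_group (msupport mu) g -> generated_group (msupport mu) h ->
    generated_group (msupport mu) (g * h)%g.
  move=> gG hG H HP; have [Hg _] := HP; have := group_closedM Hg.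
  by move=> /(_ g h); rewrite !inE; apply; [exact: gG|exact: hG].
have A0 : A !=set0 by exists (act 1%g x), 1%g.
have infA : has_inf A by split => //; exists y.
(* Some element of G moves the infimum; it or its inverse moves it down. *)
have [h [hG hlt]] :
    exists h, generated_group (msupport mu) h /\ act h (inf A) < inf A.
  have [h hG] := act_irreducible (inf A).
  rewrite neq_lt => /orP[hlt|]; first by exists h.
  move=> /(act_lt (h^-1)%g); rewrite actV => hlt.
  by exists (h^-1)%g; split => //; exact: GV.
have := act_lt (h^-1)%g hlt; rewrite actV => hlt'.
(* With this margin an orbit point lies below the image of the infimum under the inverse of h, so h
   sends that point below the infimum. *)
have e0 : 0 < act (h^-1)%g (inf A) - inf A by rewrite subr_gt0.
have [_ [g gG <-]] := inf_adherent e0 infA.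
rewrite addrC subrK => /(act_lt h); rewrite -actM.
rewrite -[act h (act _ _)]actM mulgV act1 ltNge => /negP; apply.
by apply: ge_inf => //; [exists y|exists (h * g)%g => //; exact: GM].
Qed.

Lemma reachable_gt x y : exists h, reachable h /\ x < act h y.
Proof.
have [h [_ hV /(act_lt (h^-1)%g)]] := reachable_lt x y; rewrite actV => hlt.
by exists (h^-1)%g.
Qed.

End markov_operator.

(** * The probability of staying below M forever *)

Section staying_below.
Context {R : realType} (mu : probability (homeo R) R).
Hypotheses (mu_countable : countably_supported mu)
  (mu_symmetric : symmetric_measure mu).
Variable act : homeo R -> R -> R.
Hypotheses (act1 : forall x, act 1%g x = x)
  (actM : forall g h x, act (g * h)%g x = act g (act h x))
  (act_lt : forall h, {homo act h : x y / x < y})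
  (act_irreducible : forall x,
     exists2 h, generated_group (msupport mu) h & act h x != x).
Implicit Types (x y : R) (n : nat).
Variable M : R.

Local Notation T := (step mu act).

(** The probability that the walk started at x is at most M at all times 0, ..., n;
    [stay_event_prob] makes the link. *)
Definition stay n : R -> R :=
  iter n (fun phi x => (x <= M)%R%:R * T phi x) (fun x => (x <= M)%R%:R).

Lemma stay_itv n x : 0 <= stay n x <= 1.
Proof.
elim: n x => [|n IH] x /=; first exact: indicator_itv.
have /andP[s0 s1] := @avg_itv _ mu (fun h => stay n (act h x)) 1
  (fun h => IH _).
by case: (x <= M); rewrite ?mul1r ?mul0r ?lexx ?ler01//; apply/andP.
Qed.

Lemma stay_nnbounded n : nnbounded (stay n).
Proof. by exists 1; exact: stay_itv. Qed.

Lemma stay_decr x : {homo stay ^~ x : m n / (m <= n)%N >-> n <= m}.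
Proof.
apply/nonincreasing_seqP => n; elim: n x => [|n IH] x /=.
  have /andP[s0 s1] := @avg_itv _ mu (fun h => stay 0 (act h x)) 1
    (fun h => stay_itv _ _).
  by case: (x <= M); rewrite ?mul1r ?mul0r.
apply: ler_wpM2l; first exact: ler0n.
apply: le_avg => [|h]; first exact/nnbounded_comp/stay_nnbounded.
by have /andP[-> _] := stay_itv n.+1 (act h x); exact: IH.
Qed.

Lemma stay_antimono n : {homo stay n : x y / x <= y >-> y <= x}.
Proof.
elim: n => [|n IH] x y xy /=.
  by rewrite ler_nat; case: (leP y M) => // /(le_trans xy) ->.
have [yM|_] := leP y M; last first.
  rewrite mul0r mulr_ge0//; apply: proj1; apply/andP.
  exact: (@avg_itv _ mu (fun h => stay n (act h x)) 1 (fun h => stay_itv _ _)).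
rewrite (le_trans xy yM) !mul1r; apply: le_avg => [|h].
  exact/nnbounded_comp/stay_nnbounded.
have /andP[-> _] := stay_itv n (act h y).
exact/IH/le_act.
Qed.

Definition stay_forever x := limn (stay ^~ x).
Local Notation u := stay_forever.

Lemma stay_cvg x : stay n x @[n --> \oo] --> u x.
Proof.
suff lb : has_lbound (range (stay ^~ x)).
  exact: nonincreasing_is_cvgn (@stay_decr x) lb.
by exists 0 => _ [n _ <-]; have /andP[] := stay_itv n x.
Qed.

Lemma stay_forever_le n x : u x <= stay n x.
Proof.
apply: nonincreasing_cvgn_ge; first exact: stay_decr.
by apply/cvg_ex; exists (u x); exact: stay_cvg.
Qed.

Lemma stay_forever_itv x : 0 <= u x <= 1.
Proof.
apply/andP; split; last first.
  by apply: le_trans (stay_forever_le 0 x) _; have /andP[] := stay_itv 0 x.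
apply: limr_ge; first by apply/cvg_ex; exists (u x); exact: stay_cvg.
by apply: nearW => n; have /andP[] := stay_itv n x.
Qed.

Lemma stay_forever_nnbounded : nnbounded u.
Proof. by exists 1; exact: stay_forever_itv. Qed.

(** Dominated convergence lets n tend to infinity in the recursion that defines [stay]. *)
Lemma stay_forever_eq x : u x = (x <= M)%R%:R * T u x.
Proof.
have c1 : stay n.+1 x @[n --> \oo] --> u x.
  by rewrite (cvg_shiftS (stay ^~ x)); exact: stay_cvg.
have c2 : stay n.+1 x @[n --> \oo] --> (x <= M)%R%:R * T u x.
  apply: (@cvgM _ _ _ _ (fun=> (x <= M)%R%:R) (fun n => T (stay n) x)).
    exact: cvg_cst.
  apply: (avg_cvg (K := 1)) => [n h|h]; first exact: stay_itv.
  exact: stay_cvg.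
exact: (cvg_unique _ c1 c2).
Qed.

Lemma stay_forever_antimono : {homo u : x y / x <= y >-> y <= x}.
Proof.
move=> x y xy; apply: ler_lim.
- by apply/cvg_ex; exists (u y); exact: stay_cvg.
- by apply/cvg_ex; exists (u x); exact: stay_cvg.
- by apply: nearW => n; exact: stay_antimono.
Qed.

Lemma stay_forever_gt_half x : 0 < u x -> exists z, 1 / 2 < u z.
Proof.
move=> ux0; apply: contrapT => nohalf.
have half z : u z <= 1 / 2.
  by rewrite leNgt; apply/negP => ?; apply: nohalf; exists z.
(* If u never exceeds 1/2, then 2u is at most the indicator of (-oo, M], and the common recursion of
   u and [stay] preserves this. In the limit 2u <= u. *)
have {}half n : forall z, 2 * u z <= stay n z.
  elim: n => [|n IH] z /=.
    rewrite (stay_forever_eq z); have := half z; rewrite (stay_forever_eq z).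
    by case: (z <= M); rewrite /= ?mulr0n ?mulr1n ?mul0r ?mulr0// !mul1r; lra.
  rewrite (stay_forever_eq z) mulrCA ler_wpM2l// /step.
  rewrite -avgZ//; last exact/nnbounded_comp/stay_forever_nnbounded.
  apply: le_avg => [|h]; first exact/nnbounded_comp/stay_nnbounded.
  by rewrite IH andbT; have := stay_forever_itv (act h z); lra.
have : 2 * u x <= u x.
  apply: limr_ge; first by apply/cvg_ex; exists (u x); exact: stay_cvg.
  by apply: nearW => n; exact: half.
lra.
Qed.

Lemma stay_forever_subharmonic k x : u x <= iter k T u x.
Proof.
have uT z : u z <= T u z.
  rewrite {1}stay_forever_eq; have := indicator_itv R (z <= M).
  have := @avg_itv _ mu (fun h => u (act h z)) 1 (fun h => stay_forever_itv _).
  rewrite -/(T u z); nra.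
elim: k x => [//|k IH] x /=; apply: le_trans (uT x) _.
apply: le_avg => [|h].
  exact/nnbounded_comp/nnbounded_iter_step/stay_forever_nnbounded.
by have /andP[-> _] := stay_forever_itv (act h x); exact: IH.
Qed.

(** * The square of u and the decay of its gaps *)

Let usq x := u x ^+ 2.
Let gap h x := (u (act h x) - u x) ^+ 2.

Lemma usq_nnbounded : nnbounded usq.
Proof.
by apply: nnboundedM; exact: stay_forever_nnbounded.
Qed.

Lemma square_dist_nnbounded (S : Type) (f g : S -> R) :
  nnbounded (fun s => (u (f s) - u (g s)) ^+ 2).
Proof.
exists 1 => s; rewrite sqr_ge0/=.
by have := stay_forever_itv (f s); have := stay_forever_itv (g s); nra.
Qed.

(** Expand the square: since u is subharmonic, the cross term contributes at most -2 u(x)^2, which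
    leaves -u(x)^2 after adding the constant term. *)
Lemma iter_step_variance k x :
  iter k T (fun z => (u z - u x) ^+ 2) x + usq x <= iter k T usq x.
Proof.
have /andP[ux0 _] := stay_forever_itv x.
have ub := stay_forever_nnbounded.
have dnn : nnbounded (fun z => (u z - u x) ^+ 2).
  exact: (@square_dist_nnbounded _ id (fun=> x)).
(* The expansion is written without subtraction, since additivity of T is available for nonnegative
   functions. *)
suff E : iter k T (fun z => (u z - u x) ^+ 2) x + 2 * u x * iter k T u x =
         iter k T usq x + usq x.
  have : u x * u x <= u x * iter k T u x.
    by rewrite ler_wpM2l// stay_forever_subharmonic.
  by move: E; rewrite /usq; nra.
rewrite -iter_stepZ ?mulr_ge0// -iter_stepD//; last first.
  by apply: nnboundedM => //; apply: nnbounded_cst; rewrite mulr_ge0.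
rewrite -[X in _ = _ + X](iter_step_cst mu act k x (sqr_ge0 (u x))).
rewrite -iter_stepD; [|exact: usq_nnbounded|exact/nnbounded_cst/sqr_ge0].
by congr (iter k T _ x); apply/funext => z; rewrite /usq; ring.
Qed.

Lemma iter_step_usq_incr y :
  {homo (fun n => iter n T usq y) : m n / (m <= n)%N >-> m <= n}.
Proof.
apply/nondecreasing_seqP => n; rewrite -addn1 iterD.
apply: le_iter_step => [|x].
  exact/nnbounded_iter_step/usq_nnbounded.
rewrite sqr_ge0; apply: le_trans (iter_step_variance 1 x); rewrite lerDr.
apply: nnbounded_ge0; apply: nnbounded_iter_step.
exact: (@square_dist_nnbounded _ id (fun=> x)).
Qed.

(** Reachability and the variance bound give w * gap h <= T^k usq - usq. Applying T^n leaves
    differences, at lag k, of a bounded nondecreasing sequence. *)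
Lemma iter_step_gap_cvg0 h y : reachable mu act h ->
  iter n T (gap h) y @[n --> \oo] --> (0 : R).
Proof.
move=> [k [w [w0 hP]]].
have gapb : nnbounded (gap h) by exact: (@square_dist_nnbounded _ (act h) id).
have gap_le n : w * iter n T (gap h) y <= iter (n + k) T usq y - iter n T usq y.
  rewrite lerBrDr -(iter_stepZ _ _ _ _ (ltW w0))// -iter_stepD//; last 2 first.
  - by apply: nnboundedM => //; exact/nnbounded_cst/ltW.
  - exact: usq_nnbounded.
  rewrite iterD; apply: le_iter_step => [|x].
    exact/nnbounded_iter_step/usq_nnbounded.
  rewrite addr_ge0 ?sqr_ge0//= ?(mulr_ge0 (ltW w0)) ?sqr_ge0//.
  apply: le_trans (iter_step_variance k x); rewrite lerD2r.
  exact: (hP _ (@square_dist_nnbounded _ id (fun=> x)) x).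
have incr := @iter_step_usq_incr y.
have [l sl] : exists l : R, iter n T usq y @[n --> \oo] --> l.
  suff ub : has_ubound (range (fun n => iter n T usq y)).
    exact/cvg_ex/(nondecreasing_is_cvgn incr ub).
  have [K usqK] := usq_nnbounded.
  by exists K => _ [m _ <-]; have /andP[] := iter_step_itv mu act m usqK y.
apply: (squeeze_cvgr (f := fun=> 0)
  (h := fun n => w^-1 * (iter (n + k) T usq y - iter n T usq y))).
- apply: nearW => n; rewrite ler_pdivlMl// gap_le andbT.
  by apply: nnbounded_ge0; exact: nnbounded_iter_step.
- exact: cvg_cst.
- rewrite -[X in _ --> X](mulr0 w^-1) -(subrr l).
  apply: cvgMr; apply: cvgB => //.
  by rewrite (cvg_shiftn k (fun n => iter n T usq y)).
Qed.

Lemma stay_forever_eq0 x : u x = 0.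
Proof.
have /andP[ux0 _] := stay_forever_itv x.
apply/eqP; rewrite eq_le ux0 andbT leNgt; apply/negP => {}ux0.
have [z uz] := stay_forever_gt_half ux0.
have zM : z <= M.
  rewrite leNgt; apply/negP => Mz.
  by move: uz; rewrite stay_forever_eq leNgt Mz mul0r; lra.
pose ind (b : R -> bool) x : R := (b x)%:R.
have indb b : nnbounded (ind b) by exists 1 => v; exact: indicator_itv.
pose J v := (z <= v <= M).
pose a n := iter n T (ind (fun v => v <= M)) M.
pose b n := iter n T (ind (fun v => z <= v)) M.
pose c n := iter n T (ind J) M.
(* Here a, b, c are the probabilities that X_n^M is at most M, at least z, and in [z, M]. *)
have c_ge n : 2 * u z - 1 <= 2 * c n.
  have bz : u z <= b n.
    rewrite /b -(step_duality mu_countable mu_symmetric act1 actM)//.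
    apply: le_trans (stay_forever_subharmonic n z) _.
    apply: le_iter_step => [|v]; first exact: (indb (fun v => v <= M)).
    have /andP[-> _] := stay_forever_itv v.
    exact: (stay_forever_le 0).
  (* Duality with both points equal to M turns [a n] into the probability of being at least M, and
     [z, +oo) is covered by [M, +oo) and [z, M]. *)
  have bac : b n <= a n + c n.
    rewrite /a (step_duality mu_countable mu_symmetric act1 actM)// /b /c.
    rewrite -iter_stepD; [|exact: (indb _)..].
    apply: le_iter_step => [|v]; first by apply: nnboundedD; exact: (indb _).
    rewrite ler0n/= /ind /J -natrD ler_nat.
    case: (leP z v); case: (leP v M) => [//|Mv]; case: (leP M v) => //= vM.
    by have := lt_trans Mv vM; rewrite ltxx.
  (* Inclusion-exclusion: (-oo, M] and [z, +oo) cover the line and meet in [z, M]. *)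
  have abc : a n + b n <= 1 + c n.
    have cst1 : nnbounded (fun _ : R => 1 : R) by exact: nnbounded_cst.
    rewrite /a /b /c -{1}(iter_step_cst mu act n M ler01) -!iter_stepD//.
    apply: le_iter_step => [|v]; first exact: nnboundedD.
    rewrite /ind /J.
    by case: (z <= v); case: (v <= M); rewrite /= ?mulr1n ?mulr0n; lra.
  by move: bz bac abc; move: (a n) (b n) (c n) (u z) => a' b' c' u'; lra.
have [h [hr hz]] : exists h, reachable mu act h /\ act h M < x.
  have [h []] :=
    reachable_lt mu_symmetric act1 actM act_lt act_irreducible M x.
  by exists h.
have [g [gr gz]] :=
  reachable_gt mu_symmetric act1 actM act_lt act_irreducible M z.
(* On [z, M], h leads to where u >= u x and g to where u = 0. With s = u (act h v) and t = u v, the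
   gaps sum to (s - t)^2 + t^2 = s^2/2 + (s - 2t)^2/2, hence to at least u(x)^2/2. *)
pose p := u x ^+ 2 / 2.
have p0 : 0 < p by rewrite divr_gt0// exprn_gt0.
have c_le n : p * c n <= iter n T (gap h) M + iter n T (gap g) M.
  rewrite -(iter_stepZ _ _ _ _ (ltW p0))// -iter_stepD//;
    [|exact: (@square_dist_nnbounded _ (act _) id)..].
  apply: le_iter_step => [|v].
    by apply: nnboundedD; exact: (@square_dist_nnbounded _ (act _) id).
  rewrite mulr_ge0 ?(ltW p0) ?ler0n//=.
  rewrite /ind /J; have [/andP[zv vM]|_] := boolP (z <= v <= M); last first.
    by rewrite mulr0 addr_ge0 ?sqr_ge0.
  have uh : u x <= u (act h v).
    apply: stay_forever_antimono.
    by rewrite (le_trans (le_act act_lt h vM)) ?ltW.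
  have ug : u (act g v) = 0.
    rewrite stay_forever_eq leNgt.
    by rewrite (lt_le_trans gz (le_act act_lt g zv)) mul0r.
  have : u x * u x <= u (act h v) * u (act h v) by rewrite ler_pM// ltW.
  have := sqr_ge0 (u (act h v) - 2 * u v).
  by rewrite /gap /p ug mulr1; move: (u x) (u v) (u (act h v)) => a1 a2 a3; lra.
have cv : iter n T (gap h) M + iter n T (gap g) M @[n --> \oo] --> (0 + 0 : R).
  by apply: cvgD; exact: iter_step_gap_cvg0.
have : p * (u z - 1 / 2) <= 0 + 0.
  apply: (cvgr_to_ge cv); apply: nearW => n; apply: le_trans (c_le n).
  by rewrite ler_pM2l//; have := c_ge n; lra.
by rewrite addr0 pmulr_rle0//; lra.
Qed.

End staying_below.

(** * From the Markov operator to events of the random walk *)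

Section random_walk_staying_below.
Context {R : realType} (mu : probability (homeo R) R).
Context {d : measure_display} {Omega : measurableType d}
  (P : probability Omega R) (g : nat -> {RV P >-> homeo R}).
Hypothesis g_iid : iid mu g.

Hint Resolve homeo_measurable : core.

Lemma measurable_preimage_rv n (A : set (homeo R)) : measurable (g n @^-1` A).
Proof.
by rewrite -[X in measurable X]setTI; exact: (@measurable_funPT _ _ _ _ (g n)).
Qed.

Hint Resolve measurable_preimage_rv : core.

Lemma preimage_rv_prob n (A : set (homeo R)) : P (g n @^-1` A) = mu A.
Proof. by have [_ /(_ n A)] := g_iid; exact. Qed.

(** A cylinder on the first k increments. It is the past in the induction of
    [stay_event_prob_prefix], which adds one increment at a time. *)
Definition prefix_event k (B : nat -> set (homeo R)) :=
  \bigcap_(j in `I_k) (g j @^-1` B j).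

Lemma measurable_prefix_event k B : measurable (prefix_event k B).
Proof. by apply: fin_bigcap_measurable; first exact: finite_II. Qed.

Lemma prefix_event_prob k B :
  P (prefix_event k B) = (\prod_(j < k) mu (B j))%E.
Proof.
have [gi _] := g_iid.
rewrite -(big_mkord xpredT (fun j => mu (B j))) /index_iota subn0.
pose J := [fset j | j in iota 0 k]%fset.
have -> : prefix_event k B = \bigcap_(j in [set` J]) (g j @^-1` B j).
  by congr bigcap; apply/seteqP; split => j /=; rewrite !inE mem_iota.
rewrite gi//; transitivity (\prod_(j <- J) mu (B j))%E.
  by apply: eq_bigr => j _; exact: preimage_rv_prob.
apply: perm_big; apply: uniq_perm => [||j]; rewrite ?fset_uniq ?iota_uniq//.
by rewrite !inE.
Qed.

Lemma prefix_eventS k B (A : set (homeo R)) :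
  prefix_event k B `&` g k @^-1` A =
  prefix_event k.+1 (fun j => if j == k then A else B j).
Proof.
apply/seteqP; split => w /=.
  move=> [Bw Aw] j /=; rewrite ltnS leq_eqVlt.
  by case: eqP => [-> //|_] /= /Bw.
move=> B'w; split; last by have := B'w k (ltnSn k); rewrite /= eqxx.
move=> j /= jk; have := B'w j (ltnW jk); rewrite /=.
by rewrite ltn_eqF.
Qed.

Lemma prefix_eventI_prob k B (A : set (homeo R)) :
  P (prefix_event k B `&` g k @^-1` A) = (P (prefix_event k B) * mu A)%E.
Proof.
rewrite prefix_eventS !prefix_event_prob big_ord_recr/= eqxx; congr (_ * _)%E.
by apply: eq_bigr => j _; rewrite ltn_eqF.
Qed.

Variables (c : nat -> homeo R) (F : nat -> set (homeo R)).
Hypotheses (Fc : forall i, F i `<=` [set c i]) (tF : trivIset setT F)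
  (muF : mu (\bigcup_i F i) = 1%E).
Variables (act : homeo R -> R -> R) (M : R).

(* Restricting the increments to countably many values makes this event
   measurable: it depends on several increments jointly, and the discrete
   sigma-algebra of the product of two copies of homeo R is larger than the
   product sigma-algebra. *)
Fixpoint stay_event k N y : set Omega :=
  if N is N'.+1 then
    [set w | [/\ y <= M, (\bigcup_i F i) (g k w) &
                 stay_event k.+1 N' (act (g k w) y) w]]
  else [set w | y <= M].

Lemma stay_eventS k N y : y <= M -> stay_event k N.+1 y =
  \bigcup_i (g k @^-1` F i `&` stay_event k.+1 N (act (c i) y)).
Proof.
move=> yM; apply/seteqP; split => w /=.
  by move=> [_ [i _ Fi] sw]; exists i => //; split => //; rewrite -(Fc Fi).
by move=> [i _ /= [Fi sw]]; split => //; [exists i|rewrite (Fc Fi)].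
Qed.

Lemma stay_event_gt k N y : M < y -> stay_event k N y = set0.
Proof.
rewrite ltNge => /negP yM; rewrite -subset0.
by case: N => [|N] w /=; [move/yM|move=> [/yM]].
Qed.

Lemma measurable_stay_event N k y : measurable (stay_event k N y).
Proof.
have [yM|My] := leP y M; last by rewrite stay_event_gt.
elim: N k y yM => [|N IH] k y yM.
  rewrite (_ : stay_event _ _ _ = setT)//.
  by apply/seteqP; split.
rewrite stay_eventS//; apply: bigcup_measurable => i _.
apply: measurableI => //.
have [aM|Ma] := leP (act (c i) y) M; first exact: IH.
by rewrite stay_event_gt.
Qed.

(** The Markov property. The past is kept general so that, after splitting according to the atom
    containing the next increment, that condition can join the past. *)
Lemma stay_event_prob_prefix N k B y :
  P (prefix_event k B `&` stay_event k N y) =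
  (P (prefix_event k B) * (stay mu act M N y)%:E)%E.
Proof.
elim: N k B y => [|N IH] k B y; (have [yM|My] := leP y M; last first).
- by rewrite stay_event_gt// setI0 measure0 /= leNgt My mule0.
- by rewrite /= yM mule1; congr (P _); apply/seteqP; split => // w [].
- by rewrite stay_event_gt// setI0 measure0 /= leNgt My mul0r mule0.
rewrite stay_eventS//= yM mul1r setI_bigcupr measure_semi_bigcup; last 3 first.
- move=> i; apply: measurableI; first exact: measurable_prefix_event.
  by apply: measurableI => //; exact: measurable_stay_event.
- apply/trivIsetP => i j _ _ ij.
  rewrite -subset0 => w /= [[_ [Fi _]] [_ [Fj _]]].
  have /trivIsetP/(_ i j Logic.I Logic.I ij) := tF.
  by rewrite -subset0; apply; split; [exact: Fi|exact: Fj].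
- apply: bigcup_measurable => i _.
  apply: measurableI; first exact: measurable_prefix_event.
  by apply: measurableI => //; exact: measurable_stay_event.
rewrite (avg_atoms Fc tF muF); last exact/nnbounded_comp/stay_nnbounded.
have Pfin : P (prefix_event k B) \is a fin_num.
  by apply: fin_num_measure; exact: measurable_prefix_event.
rewrite -(fineK Pfin) -nneseriesZl; last first.
  move=> i _; rewrite mule_ge0// lee_fin.
  by have /andP[] := stay_itv mu act M N (act (c i) y).
apply: eq_eseriesr => i _; rewrite (fineK Pfin).
(* The condition on [g k] becomes part of a prefix of length k+1, to which the induction hypothesis
   applies. *)
rewrite setIA prefix_eventS; apply: (etrans (IH _ _ _)).
by rewrite -prefix_eventS prefix_eventI_prob -muleA [(mu _ * _)%E]muleC.
Qed.

Lemma stay_event_prob N y : P (stay_event 0 N y) = (stay mu act M N y)%:E.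
Proof.
have := stay_event_prob_prefix N 0 (fun=> setT) y.
rewrite (_ : prefix_event _ _ = setT); last by apply/seteqP; split.
by rewrite setTI [X in (_ = X * _)%E]probability_setT mul1e.
Qed.

Hypothesis actM : forall g h x, act (g * h)%g x = act g (act h x).

Lemma walk_stay_event x w : (forall k, (\bigcup_i F i) (g k w)) ->
  (forall n, act (walk g n w) x <= M) ->
  forall N k, stay_event k N (act (walk g k w) x) w.
Proof.
move=> wF wM; elim=> [|N IH] k //=.
by split => //; rewrite -actM; exact: (IH k.+1).
Qed.

End random_walk_staying_below.

(** * Almost sure unboundedness and the limits superior and inferior *)

Section unboundedness.
Context {R : realType} (mu : probability (homeo R) R).
Hypotheses (mu_countable : countably_supported mu)
  (mu_symmetric : symmetric_measure mu).
Context {d : measure_display} {Omega : measurableType d}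
  (P : probability Omega R) (g : nat -> {RV P >-> homeo R}).
Hypothesis g_iid : iid mu g.
Variable act : homeo R -> R -> R.
Hypotheses (act1 : forall x, act 1%g x = x)
  (actM : forall g h x, act (g * h)%g x = act g (act h x))
  (act_lt : forall h, {homo act h : x y / x < y})
  (act_irreducible : forall x,
     exists2 h, generated_group (msupport mu) h & act h x != x).

(** The exceptional set is covered by two null sets: some increment misses the atoms, or the walk
    stays below some natural number forever. Each latter event has probability at most [stay] at
    every time, which tends to 0. *)
Lemma walk_unbounded x :
  {ae P, forall w, forall m : nat, exists n, m%:R < act (walk g n w) x}.
Proof.
have [c [F [Fc tF muF]]] := probability_atoms mu_countable.
pose U := \bigcup_i F i.
have outside : P.-negligible (\bigcup_k (g k @^-1` (~` U))).
  have PU k : P (g k @^-1` (~` U)) = 0%E.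
    by rewrite (preimage_rv_prob g_iid) probability_setC// muF subee.
  apply: negligible_bigcup => k; apply/negligibleP; last exact: PU.
  exact: measurable_preimage_rv.
pose S m := \bigcap_N stay_event g F act m%:R 0 N x.
have mS m : measurable (S m).
  apply: bigcapT_measurable => N.
  exact: measurable_stay_event Fc act _ _ _ _.
have below : P.-negligible (\bigcup_m S m).
  suff PS m : P (S m) = 0%E.
    by apply: negligible_bigcup => m; apply/negligibleP; last exact: PS.
  apply/eqP; rewrite eq_le measure_ge0 andbT.
  have cv : (stay mu act m%:R N x)%:E @[N --> \oo] --> (0 : \bar R).
    apply: cvg_EFin; first exact: nearW.
    rewrite -[X in _ --> X](stay_forever_eq0 mu_countable mu_symmetric act1 actM
      act_lt act_irreducible m%:R x).
    exact: stay_cvg.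
  apply: (cvge_to_ge cv); apply: nearW => N.
  rewrite -(stay_event_prob g_iid Fc tF muF) le_measure ?inE//.
    exact: measurable_stay_event Fc act _ _ _ _.
  by move=> w; apply.
have [N [mN N0 sub]] := negligibleU outside below.
exists N; split => // w /= nw; apply: sub; apply: contrapT => /not_orP[wU wS].
apply: nw => m; apply: contrapT => nm; apply: wS; exists m => // K _.
(* [walk g 0 w] is the identity, so x takes the form required by [walk_stay_event] at k = 0. *)
rewrite -[x]act1.
apply: (@walk_stay_event _ _ _ _ g F act m%:R actM x w _ _ K 0).
  by move=> k; apply: contrapT => kU; apply: wU; exists k.
by move=> n; rewrite leNgt; apply/negP => mn; apply: nm; exists n.
Qed.

End unboundedness.

Lemma limn_esup_pinfty (R : realType) (v : nat -> R) :
  (forall m : nat, exists n, m%:R < v n) -> limn_esup (EFin \o v) = +oo%E.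
Proof.
move=> unb; rewrite limn_esup_lim (_ : esups _ = cst +oo%E) ?lim_cst//.
apply/funext => n; apply/eqyP => a a0.
(* The sum exceeds every term of index below n, so a value of v above b exceeds a and must occur at
   an index at least n. *)
pose b := a + \sum_(i < n) `|v i|.
have [k vk] := unb (Num.bound b).
have s0 : 0 <= \sum_(i < n) `|v i| by apply: sumr_ge0.
have bk : b < v k.
  by apply: lt_trans vk; apply: Num.Theory.archi_boundP; rewrite /b; lra.
apply: (@le_trans _ _ (v k)%:E).
  by rewrite lee_fin; move: bk; rewrite /b; lra.
apply: ereal_sup_ubound; exists k => //=; rewrite leqNgt; apply/negP => kn.
have : `|v k| <= \sum_(i < n) `|v i|.
  by rewrite (bigD1 (Ordinal kn))//= lerDl sumr_ge0.
by move: bk (ler_norm (v k)); rewrite /b; lra.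
Qed.

Unset Implicit Arguments.

Theorem proposition4p2 (R : realType) (mu : probability (homeo R) R)
    (mu_countable : countably_supported mu)
    (mu_irreducible : irreducible_measure mu)
    (mu_symmetric : symmetric_measure mu)
    (d : measure_display) (Omega : measurableType d) (P : probability Omega R)
    (g : nat -> {RV P >-> homeo R}) (g_iid : iid mu g) (x : R) :
  {ae P, forall w : Omega,
     limn_esup (fun n => (walk g n w x)%:E) = +oo%E /\
     limn_einf (fun n => (walk g n w x)%:E) = -oo%E}.
Proof.
have up := walk_unbounded mu_countable mu_symmetric g_iid (act := @homeo_fun R)
  (fun=> erefl) (fun _ _ _ => erefl) (@homeo_increasing R) mu_irreducible x.
(* Conjugation by y -> -y again gives an increasing action without global fixed point. Its walk from
   -x is the negative of the walk from x, so its limsup yields the liminf. *)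
have reflM (h k : homeo R) (y : R) : - (h * k)%g (- y) = - h (- - k (- y)).
  by rewrite opprK.
have refl_lt (h : homeo R) : {homo (fun y => - h (- y)) : y z / y < z}.
  by move=> y z yz; rewrite ltrN2 homeo_increasing// ltrN2.
have refl_irr (y : R) :
    exists2 h, generated_group (msupport mu) h & - homeo_fun h (- y) != y.
  by have [h hG hy] := mu_irreducible (- y); exists h; rewrite // eqr_oppLR.
have := walk_unbounded mu_countable mu_symmetric g_iid
  (act := fun h y => - h (- y)) (@opprK R) reflM refl_lt refl_irr (- x).
move: up; apply: filterS2 => w up down; split; first exact: limn_esup_pinfty.
have := limn_esup_pinfty down.
rewrite (_ : _ \o _ = -%E \o (fun n => (walk g n w x)%:E)); last first.
  by apply/funext => n /=; rewrite opprK EFinN.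
by rewrite limn_esupN => /eqP; rewrite eqe_oppLR => /eqP.
Qed.
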